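(* Let $A,B,C,D\in\mathbb{C}^{n\times n}$ be group invertible matrices, and let $K=D-CA^{\#}B$ and $L=A-BD^{\#}C$. Suppose that $K=0$. If $L=0$, then $(I-BB^\#)A=0$, $A(I-C^\# C)=0$ and $B^\# AC^\# \in (CA^\# B)\{1,2\}$.
   Context: A square matrix $X$ is group invertible if there is a matrix $Y$ with $XYX=X$, $YXY=Y$ and $XY=YX$; such a $Y$ is unique, is called the group inverse of $X$, and is denoted $X^{\#}$. For a matrix $X$, $X\{1,2\}$ denotes the set of all matrices $Y$ with $XYX=X$ and $YXY=Y$. $I$ is the $n\times n$ identity matrix. *)

(* Defs.v *)
From mathcomp Require Import all_boot all_order all_algebra.
From mathcomp Require Import complex.
From mathcomp Require Import boolp classical_sets reals.

Set Implicit Arguments.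
Unset Strict Implicit.
Unset Printing Implicit Defensive.

Import GRing.Theory.
Local Open Scope classical_set_scope.
Local Open Scope ring_scope.

Section GeneralizedInverses.
Variable F : fieldType.

Definition group_inverse n (X Y : 'M[F]_n) : Prop :=
  [/\ X *m Y *m X = X, Y *m X *m Y = Y & X *m Y = Y *m X].

Definition group_invertible n (X : 'M[F]_n) : Prop :=
  exists Y, group_inverse X Y.

Lemma group_inverse_unique n (X Y Z : 'M[F]_n) :
  group_inverse X Y -> group_inverse X Z -> Y = Z.
Proof.
move=> [XYX YXY cXY] [XZX ZXZ cXZ].
have eXY : X *m Y = X *m Z.
  by rewrite -{1}XZX -mulmxA cXZ cXY -mulmxA (mulmxA X) XYX.
by rewrite -YXY -cXY eXY cXZ -mulmxA eXY mulmxA ZXZ.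
Qed.

(* The junk value 0 is taken when X is not group invertible. *)
Definition ginv n (X : 'M[F]_n) : 'M[F]_n := xget 0 [set Y | group_inverse X Y].

Lemma ginvP n (X : 'M[F]_n) : group_invertible X -> group_inverse X (ginv X).
Proof. exact: (@xgetPex _ 0 [set Y | group_inverse X Y]). Qed.

Lemma ginv_eq n (X Y : 'M[F]_n) : group_inverse X Y -> ginv X = Y.
Proof.
move=> XY; have Xinv : group_invertible X by exists Y.
exact: group_inverse_unique (ginvP Xinv) XY.
Qed.

Definition inverses12 m n (X : 'M[F]_(m, n)) : set 'M[F]_(n, m) :=
  [set Y | X *m Y *m X = X /\ Y *m X *m Y = Y].

End GeneralizedInverses.

Notation "X ^#" := (ginv X) : ring_scope.

(* Main.v *)
Require Import Defs.
From mathcomp Require Import all_boot all_order all_algebra.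
From mathcomp Require Import complex.
From mathcomp Require Import boolp classical_sets reals.

Import GRing.Theory.
Local Open Scope ring_scope.

(** [L = 0] says that [A] factors as [B *m D^# *m C], so the projector [B *m B^#] fixes [A] on the
    left and [C^# *m C] fixes it on the right. These absorptions are the first two claims; they also
    make [B] and [C] cancel in the middle of both products of the third, which then follows from the
    inverse laws of [A^#]. *)

Theorem theorem3p6 (R : realType) (n : nat) (A B C D : 'M[R[i]]_n)
    (hA : group_invertible A) (hB : group_invertible B)
    (hC : group_invertible C) (hD : group_invertible D) :
  let K := D - C *m A^# *m B in
  let L := A - B *m D^# *m C in
  K = 0 -> L = 0 ->
  [/\ (1%:M - B *m B^#) *m A = 0,
      A *m (1%:M - C^# *m C) = 0
    & B^# *m A *m C^# \in inverses12 (C *m A^# *m B)].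
Proof.
move=> K L _ /subr0_eq AE.
have [BVB _ _] := ginvP hB; have [CVC _ _] := ginvP hC.
have [AVA VAV _] := ginvP hA.
have BVA : B *m B^# *m A = A by rewrite AE !mulmxA BVB.
have AVC : A *m C^# *m C = A by rewrite AE -!mulmxA (mulmxA C) CVC.
split.
- by rewrite mulmxBl mul1mx BVA subrr.
- by rewrite mulmxBr mulmx1 mulmxA AVC subrr.
have BVAr X : B *m (B^# *m (A *m X)) = A *m X by rewrite !mulmxA BVA.
have AVCr X : A *m (C^# *m (C *m X)) = A *m X by rewrite !mulmxA AVC.
(* After absorption, the two products are [C A^# A A^# B] and [B^# A A^# A C^#]. *)
rewrite inE; split; rewrite -!mulmxA BVAr AVCr.
- by rewrite (mulmxA A^#) (mulmxA (A^# *m A)) VAV.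
- by rewrite (mulmxA A) (mulmxA (A *m A^#)) AVA.
Qed.
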